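(* Let $\Delta \ge 7$ be an integer. Every $\Delta$-regular graph $G$ satisfies $\gamma(G) \le \gamma_e(G)$.
   Context: Graphs are finite, simple and undirected. A graph is $\Delta$-regular if every vertex has exactly $\Delta$ neighbours. A dominating set of $G$ is a set $S$ of vertices such that every vertex outside $S$ has a neighbour in $S$; the domination number $\gamma(G)$ is the minimum size of a dominating set. A matching is a set of edges no two of which share a vertex; it is maximal if no edge of $G$ can be added to it. The edge domination number $\gamma_e(G)$ is the minimum size of a maximal matching of $G$. *)

(* Defs.v *)
From mathcomp Require Import all_boot.

Set Implicit Arguments.
Unset Strict Implicit.
Unset Printing Implicit Defensive.

Record sgraph := SGraph {
  vertex :> finType;
  adj : rel vertex;
  adj_sym : symmetric adj;
  adj_irrefl : irreflexive adj
}.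

Arguments adj {G} : rename.

Definition regular (G : sgraph) (d : nat) : Prop :=
  forall x : G, #|[set y | adj x y]| = d.

Definition dominating (G : sgraph) (S : {set G}) : bool :=
  [forall (x | x \notin S), exists y in S, adj x y].

(* An unordered edge is its set of endpoints, so "no two edges share a vertex"
   is pairwise disjointness, i.e. trivIset. *)
Definition edges (G : sgraph) : {set {set G}} :=
  [set [set p.1; p.2] | p : G * G & adj p.1 p.2].

Definition matching (G : sgraph) (M : {set {set G}}) : bool :=
  (M \subset edges G) && trivIset M.

Definition maximal_matching (G : sgraph) (M : {set {set G}}) : bool :=
  matching M && [forall f in edges G :\: M, ~~ matching (f |: M)].

Lemma dominating_card_ex (G : sgraph) :
  exists k, [exists S : {set G}, dominating S && (#|S| == k)].
Proof.
exists #|[set: G]|; apply/existsP; exists setT; rewrite eqxx andbT.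
by apply/forall_inP => x; rewrite in_setT.
Qed.

Lemma maximal_matching_card_ex (G : sgraph) :
  exists k, [exists M : {set {set G}}, maximal_matching M && (#|M| == k)].
Proof.
have m0 : matching (set0 : {set {set G}}).
  by rewrite /matching sub0set; apply/trivIsetP => A B; rewrite inE.
case: (arg_maxnP (fun M : {set {set G}} => #|M|) m0) => M mM maxM.
exists #|M|; apply/existsP; exists M; rewrite eqxx andbT /maximal_matching.
apply/andP; split=> //; apply/forall_inP => f; rewrite inE => /andP[fM _].
by apply/negP => /maxM; rewrite /= cardsU1 fM add1n ltnn.
Qed.

Definition domination_number (G : sgraph) : nat :=
  ex_minn (dominating_card_ex G).

Definition edge_domination_number (G : sgraph) : nat :=
  ex_minn (maximal_matching_card_ex G).

(* Main.v *)
(** Fix a minimum maximal matching [M] and choose one endpoint of every edge of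
    [M].  The chosen vertices dominate all vertices covered by [M].  An uncovered
    vertex has all its neighbours covered, so it is a clause with [Delta] literals
    over the boolean variables "which endpoint of [e] is chosen".  Two clauses
    conflict when one contains the negation of a literal of the other; the mate of
    a neighbour of [x] has at most [Delta - 1] uncovered neighbours, so every
    clause conflicts with at most [d = Delta * (Delta - 1)] others.  The lopsided
    Lovasz local lemma satisfies all clauses at once as soon as
    [(d + 1)^(d + 1) <= 2^Delta * d^d], which holds for [Delta >= 7].  Only
    conflicts matter, not shared variables; counting the latter would double [d]
    and the inequality would fail for [Delta = 7]. *)
Require Import Defs.
From mathcomp Require Import all_boot.
From mathcomp Require Import zify.

Set Implicit Arguments.
Unset Strict Implicit.
Unset Printing Implicit Defensive.

(** * The lopsided local lemma, by counting assignments *)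

Section LopsidedLocalLemma.

Variables (V I : finType) (L : I -> {set V * bool}).
Implicit Types (f : {ffun V -> bool}) (l : V * bool) (c : I) (D X : {set I}).

Definition neg l : V * bool := (l.1, ~~ l.2).
Definition satisfies f c := [exists l in L c, f l.1 == l.2].
Definition models D := [set f | [forall c in D, satisfies f c]].
Definition falsifiers c D := [set f in models D | ~~ satisfies f c].
Definition conflict c c' := [exists l in L c, neg l \in L c'].

Lemma card_modelsU1 c D :
  #|models (c |: D)| + #|falsifiers c D| = #|models D|.
Proof.
rewrite -(cardsID [set f | satisfies f c] (models D)).
have -> : models D :\: [set f | satisfies f c] = falsifiers c D.
  by apply/setP => f; rewrite !inE andbC.
congr (_ + _); apply: eq_card => f; rewrite !inE.
apply/forall_inP/andP => [Hf | [/forall_inP Hf fc] c'].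
  split; last by apply: Hf; rewrite setU11.
  by apply/forall_inP => c' Dc'; apply: Hf; rewrite setU1r.
by case/setU1P => [-> // | /Hf].
Qed.

Definition flip f (A : {set V * bool}) : {ffun V -> bool} :=
  [ffun v => f v (+) ((v, ~~ f v) \in A)].

Lemma falsifierP f c : ~~ satisfies f c -> {in L c, forall l, f l.1 = ~~ l.2}.
Proof.
by move/exists_inPn => Hf l /Hf; case: (f _) (l.2) => [] [].
Qed.

(** Recovers [A] from [flip f A]: it consists of the literals of [c] that have become true. *)
Lemma flip_falsifier_mem f c (A : {set V * bool}) l :
  ~~ satisfies f c -> A \subset L c ->
  (l \in A) = (l \in L c) && (flip f A l.1 == l.2).
Proof.
move=> /falsifierP fc /subsetP sAL; have [lL | lL] := boolP (l \in L c); last first.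
  by apply: contraNF lL => /sAL.
rewrite ffunE fc // negbK -surjective_pairing.
by case: (l \in A) (l.2) => [] [].
Qed.

(* Changing a falsifier of [c] on variables of [c] only makes literals of [c]
   true, and so cannot hurt a clause that does not conflict with [c]. *)
Lemma card_falsifiers_le c D :
  {in D, forall c', ~~ conflict c c'} ->
  2 ^ #|L c| * #|falsifiers c D| <= #|models D|.
Proof.
(* [flip] injects the pairs of a falsifier and a subset of [L c] into [models D]. *)
move=> noconf; rewrite mulnC -card_powerset -cardsX.
rewrite -(@card_in_imset _ _ (fun p => flip p.1 p.2)).
  apply/subset_leq_card/subsetP => g /imsetP[[f A] /=].
  rewrite in_setX powersetE !inE /= => /andP[/andP[/forall_inP fD fc] /subsetP sAL] ->.
  apply/forall_inP => c' Dc'; have /exists_inP[l lc' /eqP fl] := fD c' Dc'.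
  apply/exists_inP; exists l => //; rewrite ffunE fl.
  have [/sAL lL | _] := boolP (_ \in A); last by rewrite addbF.
  have /negP[] := noconf _ Dc'; apply/exists_inP; exists (neg l) => //.
  by rewrite /neg /= negbK -surjective_pairing.
move=> [f A] [g B]; rewrite !in_setX !powersetE !inE /=.
move=> /andP[/andP[_ fc] sA] /andP[/andP[_ gc] sB] eq_fg.
have eqAB : A = B.
  by apply/setP => l; rewrite (flip_falsifier_mem _ fc sA) eq_fg -flip_falsifier_mem.
subst B; congr pair; apply/ffunP => v; apply/eqP.
have /eqP := congr1 (fun h : {ffun V -> bool} => h v) eq_fg; rewrite !ffunE.
have agree b : (v, b) \in A -> f v = g v.
  by move=> /(subsetP sA) vL; rewrite (falsifierP fc vL) (falsifierP gc vL).
case vf : ((v, ~~ f v) \in A); first by rewrite (agree _ vf).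
case vg : ((v, ~~ g v) \in A); first by rewrite (agree _ vg).
by rewrite !addbF.
Qed.

Variables d : nat.

(** Telescoping: each clause of [X] put back keeps at least a fraction [d / (d + 1)] of the models.
    Assuming this bound only for proper subsets of [D] lets an induction on [#|D|] supply it. *)
Lemma card_models_setD D X :
  (forall c D', c \in D -> D' \proper D -> d.+1 * #|falsifiers c D'| <= #|models D'|) ->
  X \subset D ->
  d ^ #|X| * #|models (D :\: X)| <= d.+1 ^ #|X| * #|models D|.
Proof.
move=> IH; elim: {X}_.+1 {-2}X (ltnSn #|X|) => // n IHn X ltXn sXD.
have [-> | [c cX]] := set_0Vmem X; first by rewrite cards0 setD0.
have cardX := cardsD1 c X; rewrite cX add1n in cardX.
have propD : D :\: X \proper D.
  by rewrite properE subsetDl; apply/subsetPn; exists c; rewrite ?inE ?cX ?(subsetP sXD).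
have := IHn (X :\ c) ltac:(by rewrite -ltnS -cardX).
have -> : D :\: (X :\ c) = c |: (D :\: X).
  apply/setP => c'; rewrite !inE; case: eqP => //= ->.
  by rewrite (subsetP sXD).
have := IH c _ (subsetP sXD c cX) propD; have := card_modelsU1 c (D :\: X).
rewrite cardX !expnS => eqN leF /(_ (subset_trans (subsetDl _ _) sXD)) leN.
have {leF} leF : d * #|models (D :\: X)| <= d.+1 * #|models (c |: D :\: X)| by lia.
rewrite -!mulnA mulnCA; apply: leq_trans (leq_mul (leqnn _) leF) _.
by rewrite mulnCA leq_mul2l leN orbT.
Qed.

Variables (k : nat) (Univ : {set I}).
Hypothesis d_gt0 : 0 < d.
Hypothesis card_clause : {in Univ, forall c, #|L c| = k}.
Hypothesis card_conflict :
  {in Univ, forall c, #|[set c' in Univ | conflict c c']| <= d}.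
Hypothesis kd : d.+1 ^ d.+1 <= 2 ^ k * d ^ d.

(* Given that the clauses of [D] hold, [c] fails with probability at most
   [1 / (d + 1)]; the denominators are cleared. *)
Lemma card_falsifiers_models c D :
  c \in Univ -> D \subset Univ -> d.+1 * #|falsifiers c D| <= #|models D|.
Proof.
elim: {D}_.+1 {-2}D (ltnSn #|D|) c => // n IHn D ltDn c cU sDU.
(* Without [X], flipping bounds the failures of [c] by a fraction [2^-k]; putting [X] back costs a
   factor of at most [((d + 1) / d)^d]. *)
pose X := [set c' in D | conflict c c'].
have sXD : X \subset D by apply/subsetP => c'; rewrite inE => /andP[].
have leXd : #|X| <= d.
  apply: leq_trans (card_conflict cU); apply/subset_leq_card/subsetP => c'.
  by rewrite !inE => /andP[/(subsetP sDU) -> ->].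
have leF : 2 ^ k * #|falsifiers c D| <= #|models (D :\: X)|.
  rewrite -(card_clause cU); apply: leq_trans _ (@card_falsifiers_le c _ _); last first.
    by move=> c' /setDP[Dc']; rewrite inE Dc'.
  rewrite leq_mul2l; apply/orP; right; apply/subset_leq_card/subsetP => f.
  rewrite !inE => /andP[/forall_inP fD ->]; rewrite andbT.
  by apply/forall_inP => c' /setDP[/fD].
have leN : d ^ #|X| * #|models (D :\: X)| <= d.+1 ^ #|X| * #|models D|.
  apply: card_models_setD => // c' D' Dc' ltD'D; apply: IHn (subsetP sDU _ Dc') _.
    exact: leq_trans (proper_card ltD'D) ltDn.
  exact: subset_trans (proper_sub ltD'D) sDU.
have {}leN e : d ^ (e + #|X|) * #|models (D :\: X)| <= d.+1 ^ (e + #|X|) * #|models D|.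
  rewrite !expnD -!mulnA; apply: leq_mul leN.
  by case: e => // e; rewrite leq_exp2r.
have {leN} := leN (d - #|X|); rewrite subnK // => leN.
rewrite -(@leq_pmul2l (d.+1 ^ d)) ?expn_gt0 // mulnA -expnSr.
apply: leq_trans leN; apply: leq_trans (leq_mul kd (leqnn _)) _.
by rewrite mulnAC mulnC leq_mul2l leF orbT.
Qed.

Lemma lopsided_local_lemma : exists f, {in Univ, forall c, satisfies f c}.
Proof.
(* Telescope from no clauses, where every assignment is a model, to all of them. *)
have leN : d ^ #|Univ| * #|models (Univ :\: Univ)| <= d.+1 ^ #|Univ| * #|models Univ|.
  apply: card_models_setD => // c D cU /proper_sub; exact: card_falsifiers_models.
have models0 : [ffun=> true] \in models (Univ :\: Univ).
  by rewrite inE setDv; apply/forall_inP => c; rewrite inE.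
have : 0 < d.+1 ^ #|Univ| * #|models Univ|.
  apply: leq_trans leN; rewrite muln_gt0 expn_gt0 d_gt0 /=.
  by apply/card_gt0P; exists [ffun=> true].
rewrite muln_gt0 => /andP[_ /card_gt0P[f]]; rewrite inE => /forall_inP fU.
by exists f.
Qed.

End LopsidedLocalLemma.

(** * The numerical condition of the local lemma *)

(** Bernoulli's inequality [(1 - 1 / (d + 1))^m >= 1 - m / (d + 1)], denominators cleared. *)
Lemma bernoulli_expn d m : m <= d.+1 -> (d.+1 - m) * d.+1 ^ m <= d.+1 * d ^ m.
Proof.
elim: m => [|m IHm] ltmd; first by rewrite subn0.
have {IHm} := IHm (ltnW ltmd); rewrite !expnS; nia.
Qed.

(* Bernoulli gives [((d + 1) / d)^m <= (d + 1) / (d + 1 - m)]; take the j-th power. *)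
Lemma expnSS_le_bernoulli m j p (d := m * j) :
  m <= d -> d.+1 ^ j.+1 <= (d.+1 - m) ^ j * p -> d.+1 ^ d.+1 <= p * d ^ d.
Proof.
move=> le_md le_p; have q_gt0 : 0 < (d.+1 - m) ^ j.
  by rewrite expn_gt0 subn_gt0 ltnS le_md.
rewrite -(leq_pmul2l q_gt0) mulnA; apply: leq_trans (leq_mul le_p (leqnn _)).
rewrite !expnS -mulnA mulnCA leq_mul2l /= {2 5}/d !expnM -!expnMn.
case: j @d le_md {le_p q_gt0} => // j d le_md; rewrite leq_exp2r //.
by apply: bernoulli_expn; exact: leqW.
Qed.

Lemma local_lemma_bound Delta (d := Delta * Delta.-1) :
  7 <= Delta -> d.+1 ^ d.+1 <= 2 ^ Delta * d ^ d.
Proof.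
rewrite leq_eqVlt => /predU1P[D7 | Delta_gt7].
  (* Here [d = 42 = 7 * 6] and [43^7 <= 36^6 * 2^7] holds narrowly. The split of [d] into two
     halves, used below for larger [Delta], would fail: [43^3 > 22^2 * 2^7]. *)
  rewrite {}/d -D7; apply: (@expnSS_le_bernoulli 7 6); [by [] | rewrite !expnS expn0; lia].
have [m dE] : exists m, d = m * 2.
  exists d./2; rewrite muln2 -[LHS]odd_double_half {1}/d oddM.
  by case: (Delta) Delta_gt7 => //= n _; rewrite andNb.
have le_d : 4 * d.+1 <= 2 ^ Delta.
  rewrite /d -(subnK Delta_gt7); elim: (Delta - 8) => [|n IHn] //.
  rewrite addSn [2 ^ _]expnS; move: IHn; set p := 2 ^ _ => IHn; nia.
rewrite dE; apply: expnSS_le_bernoulli; first by rewrite leq_pmulr.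
rewrite -dE; apply: leq_trans (leq_mul (leqnn _) le_d); rewrite dE; nia.
Qed.

(** * From a maximal matching to a dominating set *)

Section Matching.

Variables (G : sgraph) (M : {set {set G}}).
Hypothesis maxM : maximal_matching M.
Implicit Types u v w x y : G.

Let nbhd x : {set G} := [set y | adj x y].

Lemma maximal_matching_edge e :
  e \in M -> exists x y, [/\ adj x y, x != y & e = [set x; y]].
Proof.
case/andP: maxM => /andP[/subsetP sME _] _ /sME /imsetP[[x y]]; rewrite inE => /= xy ->.
by exists x, y; split=> //; apply: contraTneq xy => ->; rewrite adj_irrefl.
Qed.

Lemma maximal_matching_triv : trivIset M.
Proof. by case/andP: maxM => /andP[]. Qed.

(** An edge between two uncovered vertices could be added to [M]. *)
Lemma uncovered_nbhd x : x \notin cover M -> nbhd x \subset cover M.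
Proof.
move=> xM; apply/subsetP => y; rewrite inE => xy; apply/negPn/negP => yM.
have eE : [set x; y] \in edges G by apply/imsetP; exists (x, y); rewrite ?inE.
case/andP: maxM => /andP[sME tM] /forall_inP maxlM.
have disj : {in M, forall B : {set G}, [disjoint [set x; y] & B]}.
  move=> B BM; rewrite disjoint_subset; apply/subsetP => z zxy.
  rewrite inE; apply/negP => zB.
  have zM : z \in cover M by apply/bigcupP; exists B.
  by case/set2P: zxy zM => ->; apply/negP.
have M0 : set0 \notin M.
  apply/negP => /maximal_matching_edge[a [b [_ _ /setP/(_ a)]]].
  by rewrite !inE eqxx.
have [tM' eM] := trivIsetU1 disj tM M0.
have /negP[] := maxlM [set x; y] ltac:(by rewrite inE eM).
by rewrite /matching tM' subUset sub1set eE sME.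
Qed.

(** The literal saying that a covered [v] is chosen. The variable is the edge of [M] at [v]; [pick]
    makes an arbitrary end of that edge the positive literal, so mates get opposite literals. *)
Definition endpoint v : {set G} * bool :=
  (pblock M v, Some v == [pick w in pblock M v]).

Lemma endpoint_inj : {in cover M &, injective endpoint}.
Proof.
move=> x y xM yM [eqB]; have := xM; have := yM; rewrite -!mem_pblock -eqB.
have [a [b [_ ab ->]]] := maximal_matching_edge (pblock_mem xM).
case: pickP => [w|none] => [|yB]; last by rewrite none in yB.
by move=> /set2P[]-> /set2P[]-> /set2P[]-> //=;
  rewrite !(inj_eq Some_inj) eqxx ?(negPf ab) // eq_sym (negPf ab).
Qed.

Lemma card_endpoint_nbhd x : x \notin cover M -> #|endpoint @: nbhd x| = #|nbhd x|.
Proof.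
move=> /uncovered_nbhd/subsetP sNM; rewrite card_in_imset //.
by move=> u v /sNM uM /sNM; apply: endpoint_inj.
Qed.

Lemma card_mates u : u \in cover M -> #|pblock M u :\ u| = 1.
Proof.
move=> uM; have [a [b [_ ab eB]]] := maximal_matching_edge (pblock_mem uM).
have := cardsD1 u (pblock M u); rewrite mem_pblock uM.
by rewrite eB cards2 ab => -[].
Qed.

Lemma adj_mate u w : u \in cover M -> w \in pblock M u :\ u -> adj u w.
Proof.
move=> uM; have [a [b [ab _ eB]]] := maximal_matching_edge (pblock_mem uM).
have := uM; rewrite -mem_pblock !inE eB => /set2P[]-> /andP[wu /set2P[] ew];
  move: wu; rewrite ew ?eqxx // => _; by rewrite // adj_sym.
Qed.

Lemma card_bigcup_le (T J : finType) (A : {set J}) (F : J -> {set T}) n :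
  {in A, forall i, #|F i| <= n} -> #|\bigcup_(i in A) F i| <= #|A| * n.
Proof.
move=> leFn; rewrite -sum_nat_const; apply: leq_trans (leq_sum _ leFn).
elim/big_ind2: _ => [|a S a' S' leS leS'|//]; first by rewrite cards0.
exact: leq_trans (leq_of_leqif (leq_card_setU S S')) (leq_add leS leS').
Qed.

Variable Delta : nat.
Hypothesis regG : regular G Delta.

Lemma card_conflict_endpoint x : x \notin cover M ->
  #|[set y in ~: cover M | conflict (fun z => endpoint @: nbhd z) x y]|
    <= Delta * Delta.-1.
Proof.
move=> xM; have sNM := subsetP (uncovered_nbhd xM).
(* A conflict gives a path [x], [u], [w], [y] with [u] and [w] mates. As [y] is uncovered, it
   differs from [u], which leaves [Delta.-1] choices for it. *)
pose F u := \bigcup_(w in pblock M u :\ u) (nbhd w :\ u).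
have leF : #|\bigcup_(u in nbhd x) F u| <= Delta * Delta.-1.
  rewrite -[X in X * _](regG x); apply: card_bigcup_le => u /sNM uM.
  rewrite -[leqRHS]mul1n -(card_mates uM); apply: card_bigcup_le => w wu.
  have := cardsD1 u (nbhd w); rewrite regG inE adj_sym (adj_mate uM wu) => ->.
  by rewrite add1n.
apply: leq_trans leF; apply/subset_leq_card/subsetP => y.
rewrite !inE => /andP[yM /exists_inP[_ /imsetP[u ux ->] /imsetP[w wy [eqB neq]]]].
have uM := sNM u ux; have wM := subsetP (uncovered_nbhd yM) w wy.
apply/bigcupP; exists u => //; apply/bigcupP; exists w.
  rewrite !inE eqB mem_pblock wM andbT; apply/eqP => wu.
  by move: neq; rewrite eqB wu; case: eqP.
rewrite !inE adj_sym; move: wy; rewrite inE => ->; rewrite andbT.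
by apply: contraNneq yM => ->.
Qed.

Lemma dominating_set_of_maximal_matching :
  7 <= Delta -> exists2 S : {set G}, dominating S & #|S| <= #|M|.
Proof.
move=> Delta7; pose L x := endpoint @: nbhd x.
have [||||f fsat] := @lopsided_local_lemma _ _ L (Delta * Delta.-1) Delta (~: cover M).
- by rewrite muln_gt0; lia.
- by move=> x; rewrite inE => xM; rewrite /L card_endpoint_nbhd ?regG.
- by move=> x; rewrite inE; exact: card_conflict_endpoint.
- exact: local_lemma_bound.
exists [set v in cover M | f (endpoint v).1 == (endpoint v).2].
  apply/forall_inP => x; rewrite inE => xS; apply/exists_inP.
  have [xM | xM] := boolP (x \in cover M); last first.
    have /exists_inP[_ /imsetP[y xy ->] fy] := fsat x ltac:(by rewrite inE).
    by exists y; [rewrite inE fy (subsetP (uncovered_nbhd xM)) | rewrite inE in xy].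
  rewrite xM /= in xS.
  (* If a covered [x] is not chosen, its mate carries the opposite literal and is chosen. *)
  have /eqP/cards1P[y ey] := card_mates xM.
  have yx : y \in pblock M x :\ x by rewrite ey set11.
  have eqB : pblock M y = pblock M x.
    by apply: same_pblock maximal_matching_triv _; case/setD1P: yx.
  have yM : y \in cover M by rewrite -mem_pblock eqB; case/setD1P: yx.
  exists y; last exact: adj_mate.
  rewrite inE yM /=; apply: contraNT xS => yS.
  have : (endpoint x).2 != (endpoint y).2.
    apply: contraTneq yx => eq2; rewrite (@endpoint_inj x y) ?setD11 //.
    by rewrite [LHS]surjective_pairing eq2 /= -eqB.
  move: yS => /=; rewrite eqB.
  by case: (f _); case: (Some x == _); case: (Some y == _).
(* Each edge has at most one chosen end: two of them would share the literal true under [f]. *)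
set S := [set v in _ | _]; rewrite -(@card_in_imset _ _ (pblock M) S) => [|u v].
  by apply/subset_leq_card/subsetP => _ /imsetP[u /setIdP[uM _] ->]; apply: pblock_mem.
rewrite !inE => /andP[uM /eqP fu] /andP[vM /eqP fv] eqB; apply: endpoint_inj => //.
rewrite [LHS]surjective_pairing [RHS]surjective_pairing -fu -fv /=.
by rewrite eqB.
Qed.

End Matching.

Theorem theorem1 (Delta : nat) (hDelta : 7 <= Delta)
    (G : sgraph) (hG : regular G Delta) :
  domination_number G <= edge_domination_number G.
Proof.
rewrite /edge_domination_number; case: ex_minnP => k /existsP[M /andP[maxM /eqP <-]] _.
have [S domS leSM] := dominating_set_of_maximal_matching maxM hG hDelta.
rewrite /domination_number; case: ex_minnP => j _ minj.
apply: leq_trans leSM; apply: minj; apply/existsP.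
by exists S; rewrite domS eqxx.
Qed.
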